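(* Let $w:I\to(0,\infty)$ be a decreasing weight on $I=(0,a)$, $0<a\le\infty$, let $b=\int_I w\,dm\in(0,\infty]$, $J=(0,b)$, and let $E$ be a fully symmetric Banach function space on $J$ with support $J$. Let $v\in L^0_+(I)$ be such that $v^*=w$, and let $f\in L_1+L_\infty(I)$ with $\mathrm{supp}\,f\subset\mathrm{supp}\,v$. Then $$\left(\frac{f^*}{w}\right)^{*,w}\prec\left(\frac fv\right)^{*,v}.$$ In particular, if $f/v\in E_v$ then $f^*/w\in E_w$ and $\|f^*/w\|_{E_w}\le\|f/v\|_{E_v}$.
   Context: $m$ is Lebesgue measure; functions are identified when equal a.e.; ''decreasing'' means non-increasing. $L^0(I)$ is the space of real Lebesgue measurable functions on $I=(0,a)$, and $L^0_+(I)$ its non-negative cone. For a measure $\mu$ and a $\mu$-measurable $f$ on $\Omega$, $d_f^\mu(s)=\mu\{|f|>s\}$ and $f^{*,\mu}(t)=\inf\{s>0:d_f^\mu(s)\le t\}$ for $0\le t<\mu(\Omega)$; $f^*$ denotes the rearrangement for $\mu=m$. For $v\in L^0_+(I)$, $f^{*,v}$ denotes the decreasing rearrangement of $f$ with respect to the measure $d\nu=v\,dm$ on $I$; it is a function on $(0,\nu(I))$. If $v^*=w$, then $\nu(I)=\int_I w\,dm=b$, so $f^{*,v}$ and $f^{*,w}$ are both functions on $J$. If $\mathrm{supp}\,f\subset\mathrm{supp}\,v$, one sets $(f/v)(t)=0$ for $t\notin\mathrm{supp}\,f$. For functions $g,h$ on $J$, $g\prec h$ (Hardy-Littlewood submajorization)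 means $\int_0^x g^*\,dm\le\int_0^x h^*\,dm$ for all $x\in J$ (inequality in $[0,\infty]$). A Banach function space on $J$ is a solid linear subspace $E$ of $L^0(J)$ with full support, complete under a norm such that $|f|\le|g|$ a.e. implies $\|f\|_E\le\|g\|_E$. It is symmetric if equimeasurable functions have equal norms, and fully symmetric if moreover $f\prec g$, $f\in L^0(J)$, $g\in E$ imply $f\in E$ and $\|f\|_E\le\|g\|_E$. ''Support $J$'' means $\chi_A\in E$ whenever $m(A)<\infty$. For $v\in L^0_+(I)$ with $\int_I v\,dm=b$ (in particular for $v=w$): $E_v=\{f: f^{*,v}\in E\}$ and $\|f\|_{E_v}=\|f^{*,v}\|_E$. *)

(* Defs.v *)
From HB Require Import structures.
From mathcomp Require Import all_boot all_order all_algebra.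
From mathcomp Require Import all_classical all_reals all_analysis.
From mathcomp Require Import measurable_realfun.

Set Implicit Arguments.
Unset Strict Implicit.
Unset Printing Implicit Defensive.

Import Order.TTheory GRing.Theory Num.Theory.
Import numFieldNormedType.Exports.

Local Open Scope classical_set_scope.
Local Open Scope ring_scope.
Local Open Scope ereal_scope.

(* The real line with the sigma-algebra of Lebesgue measurable sets, i.e. the
   domain of [completed_lebesgue_measure]; it is convertible to [R], but [R]
   itself carries the Borel sigma-algebra. *)
Notation lebR R := (caratheodory_type ((@wlength R idfun)^*)%mu).

Notation leb := completed_lebesgue_measure.

(* The open interval (0, a), where a may be infinite. *)
Definition itv0 {R : realType} (a : \bar R) : set R :=
  [set t : R | (0 < t)%R /\ t%:E < a].

Definition lebesgue_fun {R : realType} {d} {U : measurableType d}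
    (D : set R) (f : R -> U) : Prop :=
  measurable_fun (D : set (lebR R)) (f : lebR R -> U).

Section rearrangement.
Context {R : realType}.

(* In the next two definitions, [mu] is a measure on the subset [D] of [R], and
   functions on [D] are the restrictions of functions on [R]. They may take
   infinite values: a rearrangement is infinite at [t] when the distribution
   function stays above [t]. *)
Definition distribution_fun (mu : set R -> \bar R) (D : set R)
    (f : R -> \bar R) (s : R) : \bar R :=
  mu (D `&` [set t | s%:E < `|f t|]).

Definition rearrangement (mu : set R -> \bar R) (D : set R)
    (f : R -> \bar R) (t : R) : \bar R :=
  ereal_inf [set s%:E | s in
    [set s : R | (0 < s)%R /\ distribution_fun mu D f s <= t%:E]].

(* The measure [v dm]. *)
Definition weighted_measure (v : R -> R) (A : set R) : \bar R :=
  \int[@leb R]_(t in A) (v t)%:E.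

(* Hardy-Littlewood submajorization on J = (0, b). *)
Definition submajorized (b : \bar R) (g h : R -> \bar R) : Prop :=
  forall x : R, itv0 b x ->
    \int[@leb R]_(t in itv0 x%:E) rearrangement (@leb R) (itv0 b) g t <=
    \int[@leb R]_(t in itv0 x%:E) rearrangement (@leb R) (itv0 b) h t.

Definition equimeasurable (D : set R) (f g : R -> R) : Prop :=
  forall s : R, (0 <= s)%R ->
    distribution_fun (@leb R) D (EFin \o f) s =
    distribution_fun (@leb R) D (EFin \o g) s.

(* L_1 + L_oo on D: every function in L_p(D) extends by zero to one in L_p(R). *)
Definition L1_plus_Loo (D : set R) (f : R -> R) : Prop :=
  lebesgue_fun D f /\
  exists g h : R -> R,
    [/\ (g : lebR R -> R) \in Lfun (@leb R) 1,
        (h : lebR R -> R) \in Lfun (@leb R) +oo &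
        {ae @leb R, forall t, D t -> f t = (g t + h t)%R}].

End rearrangement.

Section function_spaces.
Context {R : realType}.

(* A space of classes of functions on [D] modulo a.e. equality is given by the
   set [E] of all its representatives; [N] is its norm, whose values outside [E]
   are irrelevant. That [E] and [N] respect a.e. equality on [D] follows from
   [bfs_solid]. *)
Record banach_function_space (D : set R) (E : set (R -> R))
    (N : (R -> R) -> R) : Prop := {
  bfs_measurable : forall f : R -> R, E f -> lebesgue_fun D f ;
  bfs_0 : E (fun=> 0%R) ;
  bfs_D : forall f g, E f -> E g -> E (f \+ g)%R ;
  bfs_Z : forall (c : R) f, E f -> E (fun t => c * f t)%R ;
  bfs_norm_ge0 : forall f, E f -> (0 <= N f)%R ;
  bfs_norm_eq0 : forall f, E f -> N f = 0%R ->
    {ae @leb R, forall t, D t -> f t = 0%R} ;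
  bfs_normZ : forall (c : R) f, E f -> N (fun t => c * f t)%R = (`|c| * N f)%R ;
  bfs_normD : forall f g, E f -> E g -> (N (f \+ g)%R <= N f + N g)%R ;
  bfs_solid : forall f g : R -> R, E f -> lebesgue_fun D g ->
    {ae @leb R, forall t, D t -> (`|g t| <= `|f t|)%R} ->
    E g /\ (N g <= N f)%R ;
  bfs_full_support : forall A : set (lebR R), measurable A -> A `<=` D ->
    0 < (@leb R) A ->
    exists2 f, E f & ~ {ae @leb R, forall t, A t -> f t = 0%R} ;
  bfs_complete : forall u : nat -> R -> R, (forall n, E (u n)) ->
    (forall e : R, (0 < e)%R -> exists k, forall i j,
      (k <= i)%N -> (k <= j)%N -> (N (u i \- u j)%R < e)%R) ->
    exists2 f, E f & (N (u n \- f)%R) @[n --> \oo] --> (0 : R)%R }.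

Definition symmetric_space (b : \bar R) (E : set (R -> R))
    (N : (R -> R) -> R) : Prop :=
  banach_function_space (itv0 b) E N /\
  forall f g : R -> R, E f -> lebesgue_fun (itv0 b) g -> equimeasurable (itv0 b) f g ->
    E g /\ N g = N f.

Definition fully_symmetric_space (b : \bar R) (E : set (R -> R))
    (N : (R -> R) -> R) : Prop :=
  symmetric_space b E N /\
  forall f g : R -> R, lebesgue_fun (itv0 b) f -> E g ->
    submajorized b (EFin \o f) (EFin \o g) ->
    E f /\ (N f <= N g)%R.

Definition has_support (D : set R) (E : set (R -> R)) : Prop :=
  forall A : set (lebR R), measurable A -> A `<=` D -> (@leb R) A < +oo ->
    E (\1_A : R -> R).

(* E_v, for a weight [v] on I = (0, a) with integral [b] and a space [E] on
   J = (0, b). A [0, oo]-valued function on J lies in [E] when it is a.e. finite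
   and its real-valued version [fine \o _] is in [E]. *)
Definition weighted_space (a b : \bar R) (E : set (R -> R)) (v : R -> R)
    (f : R -> \bar R) : Prop :=
  [/\ lebesgue_fun (itv0 a) f,
      {ae @leb R, forall t, itv0 a t -> f t \is a fin_num},
      {ae @leb R, forall t, itv0 b t ->
        rearrangement (weighted_measure v) (itv0 a) f t \is a fin_num} &
      E (fine \o rearrangement (weighted_measure v) (itv0 a) f)].

Definition weighted_norm (a : \bar R) (N : (R -> R) -> R) (v : R -> R)
    (f : R -> \bar R) : R :=
  N (fine \o rearrangement (weighted_measure v) (itv0 a) f).

End function_spaces.

(* Main.v *)
(* For a decreasing rearrangement F^* with distribution function d, Tonelli gives
   [\int_0^x F^* = \int_0^oo min(x, d(s)) ds], and min(x, d(s)) is x for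
   s < F^*(x) and d(s) for s >= F^*(x).  Taking lam = G^*(x) as cut-off, F^* is
   submajorized by G^* as soon as, for every lam >= 0, the integral of d_F over
   (lam, oo) (its tail) is at most that of d_G.  For
   F = f^*/w with respect to w dm, the tail is [\int (f^* - lam w)_+ dm], and for
   G = f/v with respect to v dm it is [\int (|f| - lam v)_+ dm].  Slicing both in
   the range, it remains to compare m{lam w <= u < f^*} with
   m{lam v <= u < |f|}: the level sets of f^* and w = v^* are initial
   segments of I of the same measures as those of |f| and v, hence nested, so
   the measure of their difference is the smallest possible.

   In the second part, integrals of f^{*,v} over (0, x) are finite when f^{*,v}
   belongs to E, which makes (f^*/w)^{*,w} finite and lets full symmetry apply. *)
Require Import Defs.
From HB Require Import structures.
From mathcomp Require Import all_boot all_order all_algebra.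
From mathcomp Require Import all_classical all_reals all_analysis.
From mathcomp Require Import measurable_realfun ess_sup_inf.
From mathcomp Require Import lra.

Set Implicit Arguments.
Unset Strict Implicit.
Unset Printing Implicit Defensive.

Import Order.TTheory GRing.Theory Num.Theory.
Import numFieldNormedType.Exports.

Local Open Scope classical_set_scope.
Local Open Scope ring_scope.
Local Open Scope ereal_scope.

(** * Measurability and length of intervals, monotone functions, and Tonelli by sections *)

Section lebesgue_line.
Context {R : realType}.

Lemma borel_lebesgue_measurable (A : set R) :
  measurable A -> measurable (A : set (lebR R)).
Proof. exact: sub_caratheodory. Qed.

Lemma borel_lebesgue_measurable_fun d (U : measurableType d) (f : R -> U) :
  measurable_fun setT f -> measurable_fun setT (f : lebR R -> U).
Proof.
by move=> mf mT Y mY; apply: borel_lebesgue_measurable; exact: mf.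
Qed.

(** Inversion is continuous off 0, and on the singleton {0} every function is measurable. *)
Lemma measurable_inv : measurable_fun setT (@GRing.inv R).
Proof.
have -> : [set: R] = [set~ 0%R] `|` [set 0%R] by rewrite setUC setUv.
apply/measurable_funU => //; first exact: measurableC.
split; last exact: measurable_fun_set1.
apply: open_continuous_measurable_fun.
  rewrite (_ : [set~ 0%R] = [set x : R | x != 0%R]); first exact: open_neq.
  by apply/seteqP; split=> x /= /eqP.
by move=> x; rewrite inE/= => x0; apply: inv_continuous; apply/eqP.
Qed.

Lemma quotient_lebesgue_measurable (f k : R -> R) (D : set R) :
  lebesgue_fun D f -> lebesgue_fun D k -> lebesgue_fun D (fun t => (f t / k t)%:E).
Proof.
move=> mf mk; apply/measurable_EFinP.
have mV : measurable_fun (D : set (lebR R)) (fun t : lebR R => (k t)^-1%R).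
  exact: measurableT_comp measurable_inv mk.
exact: (measurable_funM mf mV).
Qed.

Lemma interval_lebesgue_measurable (A : set R) :
  is_interval A -> measurable (A : set (lebR R)).
Proof.
by move=> iA; apply: borel_lebesgue_measurable; exact: is_interval_measurable.
Qed.

Lemma measurable_leb_itv (i : interval R) : measurable ([set` i] : set (lebR R)).
Proof. exact/interval_lebesgue_measurable/interval_is_interval. Qed.

Lemma leb_itv (i : interval R) :
  @leb R [set` i] = if i.1 < i.2 then (i.2 : \bar R) - i.1 else 0.
Proof. exact: lebesgue_measure_itv. Qed.

Lemma is_interval_itv0 (a : \bar R) : is_interval (@itv0 R a).
Proof.
move=> s t [s0 sa] [t0 ta] u /andP[su ut]; split; first exact: lt_le_trans su.
by apply: le_lt_trans ta; rewrite lee_fin.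
Qed.

Lemma measurable_itv0 (a : \bar R) : measurable (itv0 a : set (lebR R)).
Proof. exact/interval_lebesgue_measurable/is_interval_itv0. Qed.

Lemma itv0_fin (r : R) : itv0 r%:E = `]0%R, r[%classic.
Proof.
by apply/seteqP; split=> t /=; rewrite /itv0/= in_itv/= lte_fin => /andP.
Qed.

Lemma itv0_pinfty : @itv0 R +oo = `]0%R, +oo[%classic.
Proof.
apply/seteqP; split=> t /=; rewrite /itv0/= in_itv/= andbT; first by case.
by move=> ->; rewrite ltry.
Qed.

Lemma leb_itv0 (a : \bar R) : 0 <= a -> @leb R (itv0 a) = a.
Proof.
case: a => [r|_|//]; last first.
  by rewrite itv0_pinfty leb_itv/= ltry.
rewrite lee_fin itv0_fin leb_itv/= lte_fin => r0.
by case: ltgtP r0 => // [r0 _|<-//]; rewrite oppr0 adde0.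
Qed.

Lemma itv0I (a c : \bar R) : itv0 a `&` itv0 c = itv0 (mine a c).
Proof.
apply/seteqP; split=> t /=; rewrite /itv0/= lt_min.
  by move=> [[-> ->] [_ ->]].
by move=> [-> /andP[-> ->]].
Qed.

(** Within an interval, the preimage of an upper ray under a decreasing function is again an
    interval. This covers all rearrangements, with no assumption on the function rearranged. *)
Lemma nonincreasing_lebesgue_measurable (D : set R) (f : R -> \bar R) :
  is_interval D -> (forall s t, D s -> D t -> (s <= t)%R -> f t <= f s) ->
  lebesgue_fun D f.
Proof.
move=> iD df mD.
apply: (measurability _ (ErealGenOInfty.measurableE R)) => // _ [_ [x ->] <-].
apply: interval_lebesgue_measurable => s t /= [Ds].
rewrite in_itv/= andbT => xs [Dt]; rewrite in_itv/= andbT => xt u sut.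
have Du : D u by exact: iD sut.
split => //; rewrite in_itv/= andbT.
by apply: lt_le_trans xt _; apply: df => //; case/andP: sut.
Qed.

(* Tonelli for the product of c dm and dm restricted to A. *)
Lemma tonelli_section (A : set (lebR R * lebR R)) (c : lebR R -> \bar R) :
  measurable A -> measurable_fun setT c -> (forall t, 0 <= c t) ->
  \int[@leb R]_t (c t * @leb R (xsection A t)) =
    \int[@leb R]_s \int[@leb R]_(t in ysection A s) c t /\
  measurable_fun setT
    (fun s : lebR R => \int[@leb R]_(t in ysection A s) c t).
Proof.
move=> mA mc c0.
pose k (z : lebR R * lebR R) := c z.1 * (\1_A z)%:E.
have k0 z : 0 <= k z by rewrite mule_ge0// lee_fin.
have mk : measurable_fun setT k.
  apply: emeasurable_funM; first exact: measurableT_comp.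
  by apply/measurable_EFinP.
have kG s : \int[@leb R]_t k (t, s) = \int[@leb R]_(t in ysection A s) c t.
  rewrite [RHS]integral_mkcond; apply: eq_integral => t _.
  rewrite /k patchE indicE mem_ysection.
  by case: ifPn; rewrite ?mule1 ?mule0.
split.
- transitivity (\int[@leb R]_t \int[@leb R]_s k (t, s)).
    apply: eq_integral => t _; rewrite /k/=.
    have m1 : measurable_fun setT (fun s => (\1_A (t, s) : R)%:E).
      apply/measurable_EFinP.
      by apply: (measurableT_comp (f := \1_A : _ -> R)) => //.
    rewrite ge0_integralZl//.
    congr (_ * _).
    by rewrite -[RHS]/(fubini_F (@leb R) (EFin \o \1_A) t) indic_fubini_tonelli_FE.
  rewrite fubini_tonelli//.
  by apply: eq_integral => s _.
- under eq_fun do rewrite -kG.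
  exact: measurable_fun_fubini_tonelli_G.
Qed.

End lebesgue_line.

(** * Generalized inverses of distribution functions, and comparison of their integrals through
    tails *)

Section generalized_inverse.
Context {R : realType}.
Implicit Types (d : R -> \bar R) (s t : R).

(** The formula of [rearrangement] for an abstract distribution function, so that the Lebesgue and
    the weighted cases are handled together. *)
Definition generalized_inverse d t : \bar R :=
  ereal_inf [set s%:E | s in [set s : R | (0 < s)%R /\ d s <= t%:E]].

Lemma rearrangementE (mu : set R -> \bar R) (D : set R) (f : R -> \bar R) :
  rearrangement mu D f = generalized_inverse (distribution_fun mu D f).
Proof. by []. Qed.

(** For a decreasing function the second clause is right-continuity, phrased without limits in the
    extended reals. *)
Definition right_continuous_decreasing d : Prop :=
  (forall s t, (0 <= s)%R -> (s <= t)%R -> d t <= d s) /\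
  (forall s t, (0 <= s)%R -> t%:E < d s -> exists2 s', (s < s')%R & t%:E < d s').

Lemma generalized_inverse_ge0 d t : 0 <= generalized_inverse d t.
Proof. by apply: le_ereal_inf_tmp => _ [s [s0 _] <-]; rewrite lee_fin ltW. Qed.

Lemma generalized_inverse_decr d s t : (s <= t)%R ->
  generalized_inverse d t <= generalized_inverse d s.
Proof.
move=> st; apply: ereal_inf_le_tmp => _ [r [r0 dr] <-]; exists r => //; split => //.
by apply: le_trans dr _; rewrite lee_fin.
Qed.

(** Stated at a single [t]: two distribution functions may differ and still be on the same side of
    this one threshold. *)
Lemma eq_generalized_inverse d e t :
  (forall s, (0 < s)%R -> (d s <= t%:E) = (e s <= t%:E)) ->
  generalized_inverse d t = generalized_inverse e t.
Proof.
move=> de; congr ereal_inf; apply/seteqP.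
by split=> _ [s [s0 ds] <-]; exists s => //; split=> //; [rewrite -de|rewrite de].
Qed.

(** The Galois connection between a distribution function and its inverse. Monotonicity gives one
    direction; right-continuity gives the other, by providing room above [s] to make the inequality
    strict. *)
Lemma lt_generalized_inverse d s t : right_continuous_decreasing d ->
  (0 <= s)%R -> (s%:E < generalized_inverse d t) = (t%:E < d s).
Proof.
move=> [dd rd] s0; apply/idP/idP.
- apply: contraTT; rewrite -!leNgt => dst.
  (* The infimum runs over positive numbers only, while [s] may be 0; hence the candidates
     [s + e]. *)
  apply/lee_addgt0Pr => e e0; rewrite -EFinD; apply: ge_ereal_inf.
  exists (s + e)%:E => //; exists (s + e)%R => //; split; first by rewrite ltr_wpDl.
  by apply: le_trans dst; apply: dd => //; rewrite lerDl ltW.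
- move=> /(rd _ _ s0)[s' ss' tds']; apply: (@lt_le_trans _ _ s'%:E).
    by rewrite lte_fin.
  apply: le_ereal_inf_tmp => _ [r [r0 dr] <-]; rewrite lee_fin leNgt.
  apply/negP => rs'; have := lt_le_trans tds' (dd _ _ (ltW r0) (ltW rs')).
  by rewrite ltNge dr.
Qed.

Lemma generalized_inverse_measurable d (a : \bar R) :
  lebesgue_fun (itv0 a) (generalized_inverse d).
Proof.
apply: nonincreasing_lebesgue_measurable; first exact: is_interval_itv0.
by move=> s t _ _; exact: generalized_inverse_decr.
Qed.

(** By the Galois connection, the level set of the inverse at height [s] is the intersection of (0,
    b) with (0, d s). *)
Lemma distribution_generalized_inverse d (b : \bar R) s :
  right_continuous_decreasing d -> (forall s, 0 <= d s) -> 0 <= b -> (0 <= s)%R ->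
  distribution_fun (@leb R) (itv0 b) (generalized_inverse d) s = mine b (d s).
Proof.
move=> rd d0 b0 s0; rewrite /distribution_fun -[RHS]leb_itv0; last first.
  by rewrite le_min b0/=.
rewrite -itv0I; congr (leb _); apply/seteqP; split=> t /= [bt];
  rewrite gee0_abs ?generalized_inverse_ge0 ?lt_generalized_inverse//.
- by move=> tds; split => //; split => //; case: bt.
- by case.
Qed.

(** For t < b, truncating [d] at [b] does not affect the condition d s <= t, so an inverse is its
    own rearrangement on (0, b). *)
Lemma rearrangement_generalized_inverse d (b : \bar R) t :
  right_continuous_decreasing d -> (forall s, 0 <= d s) -> itv0 b t ->
  rearrangement (@leb R) (itv0 b) (generalized_inverse d) t =
  generalized_inverse d t.
Proof.
move=> rd d0 [t0 tb]; apply: eq_generalized_inverse => s s0.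
have b0 : 0 <= b by apply: le_trans (ltW tb); rewrite lee_fin ltW.
rewrite distribution_generalized_inverse// ?(ltW s0)//.
by rewrite ge_min leNgt tb.
Qed.

Lemma integral_generalized_inverse d (x : R) :
  right_continuous_decreasing d -> (forall s, 0 <= d s) -> (0 <= x)%R ->
  \int[@leb R]_(t in itv0 x%:E) generalized_inverse d t =
  \int[@leb R]_(s in `]0%R, +oo[%classic) mine x%:E (d s).
Proof.
move=> rd d0 x0.
pose F : lebR R -> \bar R := generalized_inverse d \_ (itv0 x%:E).
have F0 t : 0 <= F t by apply: erestrict_ge0 => u _; exact: generalized_inverse_ge0.
have mF : measurable_fun setT F.
  apply: (measurable_restrictT (T1 := lebR R) _ (measurable_itv0 x%:E)).1.
  exact: generalized_inverse_measurable.
have mE : measurable_fun setT (fun z : lebR R * lebR R => (z.2 : R)%:E).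
  apply/measurable_EFinP.
  apply: (measurableT_comp (f := id : lebR R -> R) _ measurable_snd).
  exact: borel_lebesgue_measurable_fun.
(* The region under the graph of the inverse over (0, x). Its vertical sections have length [F t];
   its section at height s > 0 is the intersection of (0, x) with (0, d s). *)
pose A := [set z : lebR R * lebR R | (0 < (z.2 : R))%R /\ (z.2 : R)%:E < F z.1].
have mA : measurable A.
  have -> : A = (setT `&` [set z : lebR R * lebR R | (fun=> 0) z < (z.2 : R)%:E]) `&`
      (setT `&` [set z : lebR R * lebR R | (z.2 : R)%:E < F z.1]).
    by rewrite !setTI; apply/seteqP; split=> z /=; rewrite lte_fin.
  apply: measurableI; apply: measurable_lte => //.
  exact: measurableT_comp.
have [+ _] := @tonelli_section R A (cst 1) mA (measurable_cst _) (fun=> lee01).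
under eq_integral.
  move=> t _; rewrite mul1e (_ : xsection A t = itv0 (F t)); last first.
    by apply/seteqP; split => s /=; rewrite /xsection/= inE.
  rewrite leb_itv0//.
  over.
rewrite -integral_mkcond => ->.
rewrite [RHS]integral_mkcond; apply: eq_integral => s _.
rewrite integral_cst ?mul1e; last exact: measurable_ysection.
rewrite patchE; case: ifPn => [|/negP]; rewrite inE/= in_itv/= andbT => s0; last first.
  rewrite (_ : ysection A s = set0) ?measure0//.
  apply/seteqP; split => t //=; rewrite /ysection/= inE => -[/s0 []].
transitivity (@leb R (itv0 x%:E `&` itv0 (d s))); last first.
  by rewrite itv0I leb_itv0// le_min lee_fin x0 d0.
congr (leb _); apply/seteqP; split=> t /=; rewrite /ysection/= inE /A/= /F patchE.
- case: ifPn => [|_ []]; last by rewrite lte_fin => s0' /(lt_trans s0'); rewrite ltxx.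
  rewrite inE => xt [_]; rewrite lt_generalized_inverse ?(ltW s0)// => tds.
  by split => //; split => //; case: xt.
- move=> [xt [_ tds]]; split => //; rewrite mem_set//.
  by rewrite lt_generalized_inverse ?(ltW s0).
Qed.

Lemma ge0_le_leb_integral (D : set R) (f g : R -> \bar R) :
  is_interval D -> lebesgue_fun D f -> lebesgue_fun D g ->
  (forall t, D t -> 0 <= f t) -> (forall t, D t -> f t <= g t) ->
  \int[@leb R]_(t in D) f t <= \int[@leb R]_(t in D) g t.
Proof.
move=> /interval_lebesgue_measurable mD mf mg f0 fg.
exact: (@ge0_le_integral _ (lebR R) R (@leb R) D mD f g f0 mf mg fg).
Qed.

Lemma integral_generalized_inverse_le d e (x : R) :
  right_continuous_decreasing d -> right_continuous_decreasing e ->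
  (forall s, 0 <= d s) -> (forall s, 0 <= e s) -> (0 <= x)%R ->
  (forall lam, (0 <= lam)%R ->
    \int[@leb R]_(s in `]lam, +oo[%classic) d s <=
    \int[@leb R]_(s in `]lam, +oo[%classic) e s) ->
  \int[@leb R]_(t in itv0 x%:E) generalized_inverse d t <=
  \int[@leb R]_(t in itv0 x%:E) generalized_inverse e t.
Proof.
move=> dd de d0 e0 x0 tail.
rewrite (integral_generalized_inverse dd)// (integral_generalized_inverse de)//.
have min0 c s : 0 <= c s -> 0 <= mine x%:E (c s).
  by move=> cs; rewrite le_min lee_fin x0.
have mmin c lam : right_continuous_decreasing c -> (0 <= lam)%R ->
    lebesgue_fun `]lam, +oo[%classic (fun s => mine x%:E (c s)).
  move=> [cd _] lam0; apply: nonincreasing_lebesgue_measurable.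
    exact: interval_is_interval.
  move=> s t; rewrite /= in_itv/= andbT => s0 _ st.
  by rewrite le_min ge_min lexx/= ge_min cd ?orbT// (le_trans lam0)// ltW.
have mtail c lam : right_continuous_decreasing c -> (0 <= lam)%R ->
    lebesgue_fun `]lam, +oo[%classic c.
  move=> [cd _] lam0; apply: nonincreasing_lebesgue_measurable.
    exact: interval_is_interval.
  move=> s t; rewrite /= in_itv/= andbT => s0 _ st.
  by apply: cd => //; rewrite (le_trans lam0)// ltW.
have := generalized_inverse_ge0 e x.
have : forall s, (0 <= s)%R -> (s%:E < generalized_inverse e x) = (x%:E < e s).
  by move=> s s0; exact: lt_generalized_inverse de s0.
(* The cut-off is the inverse of [e] at [x]. If it is infinite, [e] exceeds [x] at every s >= 0 and
   the right integrand is the constant [x]; if it is a real [lam], the half-line is split there. *)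
case: (generalized_inverse e x) => [lam| |] ltlam lam0;
  [|clear lam0|by rewrite leeNy_eq in lam0]; last first.
  apply: ge0_le_leb_integral.
  - exact: interval_is_interval.
  - exact: (mmin _ _ dd (lexx _)).
  - exact: (mmin _ _ de (lexx _)).
  - by move=> s _; apply: min0; exact: d0.
  - move=> s /=; rewrite in_itv/= andbT => s0.
    by rewrite [leRHS]min_l ?ge_min ?lexx// ltW// -ltlam ?ltry// ltW.
rewrite lee_fin in lam0.
have mmin1 c k : right_continuous_decreasing c ->
    lebesgue_fun [set` Interval (BRight 0%R) (BSide k lam)] (fun s => mine x%:E (c s)).
  move=> cd; apply: measurable_funS (mmin c _ cd (lexx _)).
    exact: measurable_leb_itv.
  by move=> s /=; rewrite !in_itv/= andbT => /andP[].
have leblam k : @leb R [set` Interval (BRight 0%R) (BSide k lam)] = lam%:E.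
  by rewrite leb_itv/= lte_fin; case: ltgtP lam0 => // [l0 _|<-]; rewrite ?oppr0 ?adde0.
have splitlam c : right_continuous_decreasing c -> (forall s, 0 <= c s) ->
    \int[@leb R]_(s in `]0%R, +oo[%classic) mine x%:E (c s) =
    \int[@leb R]_(s in `]0%R, lam]%classic) mine x%:E (c s) +
    \int[@leb R]_(s in `]lam, +oo[%classic) mine x%:E (c s).
  move=> cd c0; have split0 :
      `]0%R, +oo[%classic = `]0%R, lam]%classic `|` `]lam, +oo[%classic :> set R.
    apply/seteqP; split=> s /=; rewrite !in_itv/= !andbT.
      by move=> ->/=; case: leP; [left|right].
    by case=> [/andP[]//|]; exact: le_lt_trans.
  rewrite split0; apply: ge0_integral_setU.
  - exact: measurable_leb_itv.
  - exact: measurable_leb_itv.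
  - by rewrite -split0; exact: (mmin _ _ cd (lexx _)).
  - by move=> s _; exact: min0.
  - apply/disj_set2P/seteqP; split=> s //=; rewrite !in_itv/= !andbT.
    by move=> [/andP[_ sl]]; rewrite ltNge sl.
rewrite (splitlam d dd d0) (splitlam e de e0); apply: leeD.
(* Up to [lam], both integrals are compared with x * lam. For [e] the open interval is used, since x
   < e s holds exactly when s < lam; [k] selects the open or the closed end. *)
- have cstlam k : \int[@leb R]_(s in [set` Interval (BRight 0%R) (BSide k lam)])
      (cst x%:E s) = x%:E * lam%:E.
    rewrite integral_cst; first by congr (_ * _); exact: leblam.
    exact: measurable_leb_itv.
  apply: (@le_trans _ _ (x%:E * lam%:E)).
    rewrite -(cstlam false); apply: ge0_le_leb_integral.
    + exact: interval_is_interval.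
    + exact: mmin1.
    + exact: measurable_cst.
    + by move=> s _; apply: min0; exact: d0.
    + by move=> s _; rewrite ge_min lexx.
  rewrite -(cstlam true).
  apply: (@le_trans _ _ (\int[@leb R]_(s in `]0%R, lam[%classic) mine x%:E (e s))).
    apply: ge0_le_leb_integral.
    + exact: interval_is_interval.
    + exact: measurable_cst.
    + exact: mmin1.
    + by move=> s _; rewrite lee_fin.
    + move=> s /=; rewrite in_itv/= => /andP[s0 sl].
      by rewrite min_l ?lexx// ltW// -ltlam ?lte_fin// ltW.
  apply: ge0_subset_integral.
  + exact: measurable_leb_itv.
  + exact: measurable_leb_itv.
  + exact: mmin1.
  + by move=> s _; apply: min0; exact: e0.
  + by move=> s /=; rewrite !in_itv/= => /andP[-> /ltW].
(* Beyond [lam], the minimum is at most [d s] on the left and equals [e s] on the right, so the tail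
   hypothesis applies. *)
- apply: (@le_trans _ _ (\int[@leb R]_(s in `]lam, +oo[%classic) d s)).
    apply: ge0_le_leb_integral.
    + exact: interval_is_interval.
    + exact: mmin.
    + exact: mtail.
    + by move=> s _; apply: min0; exact: d0.
    + by move=> s _; rewrite ge_min lexx orbT.
  apply: le_trans (tail _ lam0) _.
  apply: ge0_le_leb_integral.
  + exact: interval_is_interval.
  + exact: mtail.
  + exact: mmin.
  + by move=> s _; exact: e0.
  + move=> s /=; rewrite in_itv/= andbT => ls.
    rewrite min_r// leNgt -ltlam ?(le_trans lam0 (ltW ls))// lte_fin.
    by rewrite -leNgt ltW.
Qed.

End generalized_inverse.

(** * Distribution functions with respect to a weighted measure *)

Section weighted_distribution.
Context {R : realType}.
Variables (D : set R) (psi : R -> R) (F : R -> \bar R).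
Hypotheses (mD : measurable (D : set (lebR R))) (mpsi : lebesgue_fun D psi)
  (psi_ge0 : forall t, D t -> (0 <= psi t)%R) (mF : lebesgue_fun D F).

Lemma measurable_level_set s : measurable (D `&` [set t | s%:E < `|F t|] : set (lebR R)).
Proof.
have := @emeasurable_fun_o_infty _ (lebR R) _ D (fun t => `|F t|) mD _ s%:E.
by apply; exact: measurableT_comp.
Qed.

Lemma distribution_weighted_ge0 s : 0 <= distribution_fun (weighted_measure psi) D F s.
Proof. by apply: integral_ge0 => t [/psi_ge0]; rewrite lee_fin. Qed.

(** Right-continuity is continuity from below of the weighted measure along the sets where |F| > s +
    1/(n+1), so infinite values are harmless. *)
Lemma distribution_weighted_rcd :
  right_continuous_decreasing (distribution_fun (weighted_measure psi) D F).
Proof.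
have mpsiE (A : set (lebR R)) : A `<=` D -> measurable_fun A (fun t : lebR R => (psi t)%:E).
  by move=> AD; apply/measurable_EFinP; exact: measurable_funS mpsi.
split=> [s t s0 st|s t s0].
  apply: ge0_subset_integral; [exact: measurable_level_set..| | |].
  - by apply: mpsiE => r [].
  - by move=> r [/psi_ge0]; rewrite lee_fin.
  - by move=> r [Dr] /= tF; split => //=; apply: le_lt_trans tF; rewrite lee_fin.
(* If no level above [s] has measure greater than [t], the measures of all [A n] are at most [t],
   and so is their limit. *)
apply: contraPP => nex; apply/negP; rewrite -leNgt.
pose A n := D `&` [set t | (s + n.+1%:R^-1)%:E < `|F t|].
have ndA : nondecreasing_seq (A : nat -> set (lebR R)).
  move=> m n mn; rewrite subsetEset => r [Dr] /= h; split => //=.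
  apply: le_lt_trans h; rewrite lee_fin lerD2l lef_pV2 ?posrE//.
  by rewrite ler_nat.
have UA : D `&` [set t | s%:E < `|F t|] = \bigcup_n A n.
  apply/seteqP; split=> [r [Dr] /= sF|r [n _ [Dr] /= h]]; last first.
    by split => //=; apply: lt_trans h; rewrite lte_fin ltrDl invr_gt0.
  have [q sq qF] : exists2 q, (s < q)%R & q%:E <= `|F r|.
    case: `|F r| sF => [y|_|//].
      by rewrite lte_fin => sy; exists y.
    by exists (s + 1)%R; rewrite ?ltrDl// leey.
  have [n nq] := ltr_add_invr sq.
  by exists n => //; split => //=; apply: lt_le_trans qF; rewrite lte_fin.
rewrite /distribution_fun UA /weighted_measure.
have mA n : measurable (A n : set (lebR R)) by exact: measurable_level_set.
have mpsiA n : measurable_fun (A n : set (lebR R)) (fun t : lebR R => (psi t)%:E).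
  by apply: mpsiE => r [].
have psiA0 n r : A n r -> 0 <= (psi r)%:E by move=> [/psi_ge0]; rewrite lee_fin.
have /cvg_lim <- // : \int[@leb R]_(r in A n) (psi r)%:E @[n --> \oo] -->
    \int[@leb R]_(r in \bigcup_n A n) (psi r)%:E.
  exact: ge0_nondecreasing_set_cvg_integral.
apply: lime_le.
  apply: ereal_nondecreasing_is_cvgn.
  exact: ge0_nondecreasing_set_nondecreasing_integral.
apply: nearW => n; rewrite leNgt; apply/negP => h; apply: nex.
by exists (s + n.+1%:R^-1)%R; rewrite ?ltrDl ?invr_gt0.
Qed.

End weighted_distribution.

(** * Tails as integrals of measures of level sets, and the extremality of initial segments *)

Section levels.
Context {R : realType}.

(* Both sides equal the integral of (phi - lam psi)_+ over D. *)
Lemma integral_tail_distribution (D : set R) (phi psi : R -> R) (lam : R) :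
  measurable (D : set (lebR R)) -> lebesgue_fun D phi -> lebesgue_fun D psi ->
  (forall t, D t -> (0 <= phi t)%R) -> (forall t, D t -> (0 <= psi t)%R) ->
  (forall t, D t -> psi t = 0%R -> phi t = 0%R) -> (0 <= lam)%R ->
  \int[@leb R]_(s in `]lam, +oo[%classic)
     distribution_fun (weighted_measure psi) D (fun t => (phi t / psi t)%:E) s =
  \int[@leb R]_u @leb R (D `&` [set t | (lam * psi t <= u < phi t)%R]) /\
  measurable_fun setT (fun u : lebR R =>
    @leb R (D `&` [set t | (lam * psi t <= u < phi t)%R])).
Proof.
move=> mD mphi mpsi phi0 psi0 psiphi lam0.
(* Extension by zero puts Tonelli on the whole plane; points outside [D] have empty sections in both
   regions below. *)
pose p : lebR R -> R := phi \_ D; pose q : lebR R -> R := psi \_ D.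
have mp : measurable_fun setT p by exact: (measurable_restrictT (T1 := lebR R) _ mD).1.
have mq : measurable_fun setT q by exact: (measurable_restrictT (T1 := lebR R) _ mD).1.
have pE t : D t -> p t = phi t by move=> Dt; rewrite /p patchE mem_set.
have qE t : D t -> q t = psi t by move=> Dt; rewrite /q patchE mem_set.
have pN t : ~ D t -> p t = 0%R by move=> Dt; rewrite /p patchE memNset.
have qN t : ~ D t -> q t = 0%R by move=> Dt; rewrite /q patchE memNset.
have q0 t : (0 <= q t)%R.
  by have [/[dup] Dt /qE ->|/qN ->//] := pselect (D t); exact: psi0.
have qp t : q t = 0%R -> p t = 0%R.
  have [Dt|Dt] := pselect (D t); last by rewrite pN.
  by rewrite qE// pE//; exact: psiphi.
have msnd : measurable_fun setT (fun z : lebR R * lebR R => (z.2 : R)).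
  apply: (measurableT_comp (f := id : lebR R -> R) _ measurable_snd).
  exact: borel_lebesgue_measurable_fun.
have mpfst : measurable_fun setT (fun z : lebR R * lebR R => p z.1).
  exact: measurableT_comp.
have mqfst : measurable_fun setT (fun z : lebR R * lebR R => q z.1).
  exact: measurableT_comp.
have mlt (f g : lebR R * lebR R -> R) : measurable_fun setT f ->
    measurable_fun setT g -> measurable [set z | (f z < g z)%R].
  move=> /measurable_EFinP mf /measurable_EFinP mg.
  by have := measurable_lte measurableT mf mg; rewrite setTI; under eq_set do rewrite lte_fin.
have mle (f g : lebR R * lebR R -> R) : measurable_fun setT f ->
    measurable_fun setT g -> measurable [set z | (f z <= g z)%R].
  move=> /measurable_EFinP mf /measurable_EFinP mg.
  by have := measurable_lee measurableT mf mg; rewrite setTI; under eq_set do rewrite lee_fin.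
(* [A] encodes lam < s < phi/psi with the division cleared; [B] is the region between lam psi and
   phi. The first is measured with weight [q], the second with weight 1. *)
pose A := [set z : lebR R * lebR R | (lam < z.2)%R] `&`
  [set z : lebR R * lebR R | (z.2 * q z.1 < p z.1)%R].
pose B := [set z : lebR R * lebR R | (0 <= (z.2 : R))%R] `&`
  ([set z : lebR R * lebR R | (lam * q z.1 <= z.2)%R] `&`
   [set z : lebR R * lebR R | ((z.2 : R) < p z.1)%R]).
have mA : measurable A.
  apply: measurableI; first exact: mlt.
  by apply: mlt => //; exact: measurable_funM.
have mB : measurable B.
  apply: measurableI; first exact: mle.
  by apply: measurableI; [apply: mle => //; exact: measurable_funM|exact: mlt].
have [TA _] := @tonelli_section R A (fun t => (q t)%:E) mA
  ((measurable_EFinP _ _).2 mq) q0.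
have [TB mTB] := @tonelli_section R B (cst 1) mB (measurable_cst _) (fun=> lee01).
have Bsec u : \int[@leb R]_(t in ysection B u) cst 1 t =
    @leb R (D `&` [set t | (lam * psi t <= u < phi t)%R]).
  rewrite integral_cst ?mul1e; last exact: measurable_ysection.
  congr (leb _); apply/seteqP; split=> t; rewrite /ysection/= inE /B/=.
  - move=> [u0 [lu up]]; have [Dt|Dt] := pselect (D t); last first.
      by move: up; rewrite pN// ltNge u0.
    by split => //; rewrite -qE// -pE// lu.
  - move=> [Dt /andP[lu up]]; rewrite pE// qE//; split => //.
    by apply: le_trans lu; rewrite mulr_ge0// psi0.
split; last by under eq_fun do rewrite -Bsec.
transitivity (\int[@leb R]_s \int[@leb R]_(t in ysection A s) (q t)%:E).
  rewrite integral_mkcond; apply: eq_integral => s _; rewrite patchE.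
  case: ifPn => [|/negP]; rewrite inE/= in_itv/= andbT => ls; last first.
    rewrite (_ : ysection A s = set0) ?integral_set0//.
    by apply/seteqP; split => t //; rewrite /ysection/= inE => -[/ls].
  have s0 : (0 < s)%R by exact: le_lt_trans ls.
  have -> : ysection A s = D `&` [set t | s%:E < `|(phi t / psi t)%:E|].
    apply/seteqP; split=> t; rewrite /ysection/= inE /A/=.
    - move=> [_]; have [Dt|Dt] := pselect (D t); last first.
        by rewrite pN// qN// mulr0 ltxx.
      rewrite pE// qE// => sp; split => //.
      have : (0 < psi t)%R.
        rewrite lt_neqAle psi0// andbT; apply/eqP => /esym h.
        by move: sp; rewrite h psiphi// mulr0 ltxx.
      move=> psit; rewrite lte_fin ger0_norm; last by rewrite divr_ge0// ?phi0// ltW.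
      by rewrite ltr_pdivlMr.
    - move=> [Dt]; rewrite pE// qE// lte_fin ger0_norm; last first.
        by rewrite divr_ge0 ?phi0 ?psi0.
      move=> sp; split => //; move: sp.
      (* Division by 0 gives 0, so a quotient exceeding s > 0 forces psi t to be nonzero. *)
      have [->|pn] := eqVneq (psi t) 0%R.
        by rewrite invr0 mulr0 => /(lt_trans s0); rewrite ltxx.
      by rewrite ltr_pdivlMr// lt_neqAle eq_sym pn psi0.
  by apply: eq_integral => t; rewrite inE => -[Dt _]; rewrite qE.
rewrite -TA; under [RHS]eq_integral do rewrite -Bsec.
rewrite -TB; apply: eq_integral => t _; rewrite mul1e.
have -> : xsection B t = `[(lam * q t)%R, p t[%classic.
  apply/seteqP; split=> u; rewrite /xsection/= inE /B/= in_itv/=.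
    by move=> [_ [-> ->]].
  by move=> /andP[lu ->]; split => //; apply: le_trans lu; rewrite mulr_ge0.
(* Fibrewise comparison: where [q] vanishes so does [p], and both sides are 0; elsewhere, scaling by
   [q t] turns the length of (lam, p/q) into that of (lam q, p). *)
have [qt0|qt0] := eqVneq (q t) 0%R.
  by rewrite qt0 mul0e mulr0 qp// leb_itv/= ltxx.
have {}qt0 : (0 < q t)%R by rewrite lt_neqAle eq_sym qt0 q0.
have -> : xsection A t = `]lam, (p t / q t)%R[%classic.
  apply/seteqP; split=> u; rewrite /xsection/= inE /A/= in_itv/= ltr_pdivlMr//.
    by move=> [-> ->].
  by move=> /andP[].
rewrite !leb_itv/= !lte_fin ltr_pdivlMr//; case: ifPn => // _; last by rewrite mule0.
rewrite -EFinB -EFinM; congr (_%:E).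
by rewrite mulrBr mulrCA divff ?mulr1 ?gt_eqF// [(q t * _)%R]mulrC.
Qed.

Lemma leb_aeS (P Q : R -> Prop) : (forall t, P t -> Q t) ->
  {ae @leb R, forall t, P t} -> {ae @leb R, forall t, Q t}.
Proof.
by move=> PQ [N [mN N0 PN]]; exists N; split => // t nQ; apply: PN => /PQ.
Qed.

Lemma leb_aeI (P Q : R -> Prop) : {ae @leb R, forall t, P t} ->
  {ae @leb R, forall t, Q t} -> {ae @leb R, forall t, P t /\ Q t}.
Proof.
move=> aP aQ; have := negligibleU aP aQ; apply: negligibleS => t /= nPQ.
by have [Pt|] := pselect (P t); [right => Qt; apply: nPQ|left].
Qed.

Lemma leb_le_ae (A B : set (lebR R)) : measurable A -> measurable B ->
  {ae @leb R, forall t, A t -> B t} -> @leb R A <= @leb R B.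
Proof.
move=> mA mB [N [mN N0 AB]].
apply: (@le_trans _ _ (@leb R (B `|` N))).
  apply: le_measure; rewrite ?inE//; first exact: measurableU.
  by move=> t At; have [|nBt] := pselect (B t); [left|right; apply: AB => /(_ At)].
apply: le_trans (measureU2 (@leb R) mB mN) _.
rewrite -[leRHS]adde0; apply: leeD2l.
by rewrite le_eqVlt; apply/orP; left; apply/eqP; exact: N0.
Qed.

(* Shifting mass to the left: X and Y play the role of the rearrangements of A
   and B, which are nested. *)
Lemma leb_setD_initial_segments (D X Y A B : set (lebR R)) :
  measurable X -> measurable Y -> measurable A -> measurable B ->
  (forall t : R, D t -> (0 < t)%R) -> X `<=` D -> Y `<=` D ->
  (forall s t : R, X t -> D s -> (s <= t)%R -> X s) ->
  (forall s t : R, Y t -> D s -> (s <= t)%R -> Y s) ->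
  @leb R X <= @leb R A -> @leb R B <= @leb R Y ->
  @leb R (X `\` Y) <= @leb R (A `\` B).
Proof.
move=> mX mY mA mB D0 XD YD Xi Yi XA BY.
(* A point [x] of [X] outside [Y] lies to the right of [Y]. Hence [Y] is contained in [X] and has
   finite measure, so m(Y) can be added to both sides and cancelled. *)
have [XY|/existsNP[x /not_implyP[Xx nYx]]] := pselect (X `<=` Y).
  by rewrite (_ : X `\` Y = set0) ?measure0// setD_eq0.
have Yx : Y `<=` itv0 x%:E.
  move=> y Yy; split; first exact/D0/YD.
  rewrite lte_fin ltNge; apply/negP => xy; apply: nYx.
  by apply: Yi xy => //; exact: XD.
have YX : Y `<=` X.
  move=> y Yy; apply: (Xi y x Xx (YD _ Yy)).
  by have [_] := Yx _ Yy; rewrite lte_fin => /ltW.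
have Yfin : @leb R Y \is a fin_num.
  rewrite ge0_fin_numE//; apply: (@le_lt_trans _ _ (@leb R (itv0 x%:E))).
    by apply: le_measure; rewrite ?inE//; exact: measurable_itv0.
  by rewrite leb_itv0 ?ltry// lee_fin ltW//; exact/D0/XD.
rewrite -(leeD2rE _ _ Yfin); apply: (@le_trans _ _ (@leb R X)).
  rewrite -{2}(setDUK YX) [X in _ <= leb X]setUC measureU//; last first.
    by apply/seteqP; split=> t // -[[]].
  exact: measurableD.
apply: le_trans XA _; apply: (@le_trans _ _ (@leb R (A `\` B `|` B))).
  apply: le_measure; rewrite ?inE//; first by apply: measurableU => //; exact: measurableD.
  by move=> t At; have [|nBt] := pselect (B t); [right|left].
apply: le_trans (measureU2 (@leb R) _ mB) _; first exact: measurableD.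
by rewrite leeD2l.
Qed.

End levels.

(** * Comparison of the tails and of the integrals of the rearrangements *)

Section submajorization.
Context {R : realType}.

(** Lebesgue measure as the weight 1, which makes the results on weighted measures available for
    it. *)
Lemma distribution_lebE (D : set R) (F : R -> \bar R) :
  measurable (D : set (lebR R)) -> lebesgue_fun D F ->
  distribution_fun (@leb R) D F = distribution_fun (weighted_measure (cst 1%R)) D F.
Proof.
move=> mD mF; apply/funext => s; rewrite /distribution_fun /weighted_measure.
rewrite -[LHS]mul1e -integral_cst//; exact: measurable_level_set.
Qed.

Lemma distribution_leb_rcd (D : set R) (F : R -> \bar R) :
  measurable (D : set (lebR R)) -> lebesgue_fun D F ->
  right_continuous_decreasing (distribution_fun (@leb R) D F).
Proof.
move=> mD mF; rewrite distribution_lebE//.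
by apply: distribution_weighted_rcd => //; exact: measurable_cst.
Qed.

Lemma distribution_leb_le (D : set R) (F : R -> \bar R) s :
  measurable (D : set (lebR R)) -> lebesgue_fun D F ->
  distribution_fun (@leb R) D F s <= @leb R D.
Proof.
by move=> mD mF; apply: le_measure; rewrite ?inE//; exact: measurable_level_set.
Qed.

(** Equimeasurability of a function and its rearrangement: the truncation at [a] disappears because
    no level set in (0, a) is longer than [a]. *)
Lemma leb_rearrangement_level (a : \bar R) (F : R -> \bar R) s :
  0 <= a -> lebesgue_fun (itv0 a) F -> (0 <= s)%R ->
  @leb R (itv0 a `&` [set t | s%:E < rearrangement (@leb R) (itv0 a) F t]) =
  distribution_fun (@leb R) (itv0 a) F s.
Proof.
move=> a0 mF s0.
have mI := measurable_itv0 a.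
have := distribution_generalized_inverse
  (distribution_leb_rcd mI mF) (fun s => measure_ge0 _ _) a0 s0.
rewrite min_r; last first.
  by apply: le_trans (distribution_leb_le _ mI mF) _; rewrite leb_itv0.
move=> <-; rewrite {2}/distribution_fun; congr (leb (_ `&` _)).
by apply/funext => t /=; rewrite gee0_abs// generalized_inverse_ge0.
Qed.

(** [phi] and [psi] stand for |f| and v, corrected on a null set so that signs and supports are
    right at every point of I. *)
Variables (a : \bar R) (phi psi w : R -> R).
Hypotheses (a_ge0 : 0 <= a)
  (w_gt0 : forall t, itv0 a t -> (0 < w t)%R)
  (w_decr : forall s t, itv0 a s -> itv0 a t -> (s <= t)%R -> (w t <= w s)%R)
  (mphi : lebesgue_fun (itv0 a) phi) (mpsi : lebesgue_fun (itv0 a) psi)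
  (phi_ge0 : forall t, itv0 a t -> (0 <= phi t)%R)
  (psi_ge0 : forall t, itv0 a t -> (0 <= psi t)%R)
  (psi_phi : forall t, itv0 a t -> psi t = 0%R -> phi t = 0%R)
  (psi_rearr : {ae @leb R, forall t, itv0 a t ->
     rearrangement (@leb R) (itv0 a) (EFin \o psi) t = (w t)%:E})
  (phi_rearr_fin : forall t, itv0 a t ->
     rearrangement (@leb R) (itv0 a) (EFin \o phi) t \is a fin_num).

Let I : set (lebR R) := itv0 a.
Let mI : measurable I := measurable_itv0 a.
Let phistar t : R := fine (rearrangement (@leb R) (itv0 a) (EFin \o phi) t).

Let phistarE t : itv0 a t ->
  (phistar t)%:E = rearrangement (@leb R) (itv0 a) (EFin \o phi) t.
Proof. by move=> /phi_rearr_fin/fineK. Qed.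

Let phistar_ge0 t : (0 <= phistar t)%R.
Proof. exact/fine_ge0/generalized_inverse_ge0. Qed.

Let phistar_decr s t : itv0 a s -> itv0 a t -> (s <= t)%R -> (phistar t <= phistar s)%R.
Proof.
by move=> Is It st; rewrite -lee_fin !phistarE//; exact: generalized_inverse_decr.
Qed.

Let mphistar : lebesgue_fun (itv0 a) phistar.
Proof.
apply/measurable_EFinP; apply: nonincreasing_lebesgue_measurable.
  exact: is_interval_itv0.
by move=> s t Is It st; rewrite lee_fin phistar_decr.
Qed.

Lemma weight_lebesgue_measurable : lebesgue_fun (itv0 a) w.
Proof.
apply/measurable_EFinP; apply: nonincreasing_lebesgue_measurable.
  exact: is_interval_itv0.
by move=> s t Is It st; rewrite lee_fin w_decr.
Qed.

(** For u >= 0 the two sets are the differences X \ Y and A \ B defined in the proof. Monotonicity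
    makes X and Y initial segments of I, and equimeasurability compares X with A and Y with B. *)
Lemma leb_levels_le (lam u : R) : (0 <= lam)%R ->
  @leb R (itv0 a `&` [set t | (lam * w t <= u < phistar t)%R]) <=
  @leb R (itv0 a `&` [set t | (lam * psi t <= u < phi t)%R]).
Proof.
move=> lam0; have [u0|u0] := ltP u 0%R.
  rewrite (_ : _ `&` _ = set0) ?measure0//; apply/seteqP; split => t // [It] /=.
  by move=> /andP[/le_lt_trans/(_ u0)]; rewrite ltNge mulr_ge0// ltW// w_gt0.
have mEphi : lebesgue_fun (itv0 a) (EFin \o phi) by exact/measurable_EFinP.
have mEpsi : lebesgue_fun (itv0 a) (EFin \o psi) by exact/measurable_EFinP.
pose X : set (lebR R) := I `&` [set t | (u < phistar t)%R].
pose Y : set (lebR R) := I `&` [set t | (u < lam * w t)%R].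
pose A : set (lebR R) := I `&` [set t | (u < phi t)%R].
pose B : set (lebR R) := I `&` [set t | (u < lam * psi t)%R].
have level (f : R -> R) : lebesgue_fun (itv0 a) f ->
    measurable (I `&` [set t | (u < f t)%R]).
  move=> /measurable_EFinP mf.
  by have := measurable_lte mI (measurable_cst u%:E) mf; under eq_set do rewrite lte_fin.
have mX : measurable X by exact: level.
have mY : measurable Y.
  by apply: (level (fun t => lam * w t)%R); apply: measurable_funM => //;
    exact: weight_lebesgue_measurable.
have mA : measurable A by exact: level.
have mB : measurable B.
  by apply: (level (fun t => lam * psi t)%R); exact: measurable_funM.
have setDE' (f g : R -> R) : (I `&` [set t | (u < f t)%R]) `\` (I `&` [set t | (u < g t)%R]) =
    itv0 a `&` [set t | (g t <= u < f t)%R].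
  apply/seteqP; split=> t /=.
    by move=> [[It uf] nug]; split => //; rewrite uf andbT leNgt; apply/negP => ug; apply: nug.
  by move=> [It /andP[gu uf]]; split => // -[_]; rewrite ltNge gu.
rewrite -!setDE'; apply: (@leb_setD_initial_segments R I X Y A B) => //.
- by move=> t [].
- by move=> t [].
- by move=> t [].
- move=> s t [It ut] Is st; split => //=; apply: lt_le_trans ut _; exact: phistar_decr.
- move=> s t [It ut] Is st; split => //=; apply: lt_le_trans ut _.
  by rewrite ler_wpM2l// w_decr.
- have -> : X = itv0 a `&` [set t | u%:E < rearrangement (@leb R) (itv0 a) (EFin \o phi) t].
    by apply/seteqP; split=> t [It] /= ut; split => //; move: ut; rewrite /= -phistarE// lte_fin.
  rewrite leb_rearrangement_level// /distribution_fun.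
  apply: le_measure; rewrite ?inE//; first exact: (measurable_level_set mI mEphi).
  by move=> t [It] /=; rewrite lte_fin ger0_norm ?phi_ge0.
(* Dividing the level by [lam] reduces B to a level set of psi; for lam = 0 it is empty, as u >=
   0. *)
- have [lamE|lamn0] := eqVneq lam 0%R.
    rewrite (_ : B = set0) ?measure0//; apply/seteqP; split => t // [It] /=.
    by rewrite lamE mul0r ltNge u0.
  have {}lam0 : (0 < lam)%R by rewrite lt_neqAle eq_sym lamn0.
  (* [Z] is [Y] with [w] replaced by the rearrangement of [psi], which agrees with it only a.e. *)
  pose Z := itv0 a `&` [set t | (u / lam)%:E < rearrangement (@leb R) (itv0 a) (EFin \o psi) t].
  have mZ : measurable (Z : set (lebR R)).
    have := measurable_lte mI (measurable_cst (u / lam)%:E)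
      (generalized_inverse_measurable (distribution_fun (@leb R) (itv0 a) (EFin \o psi)) (a := a)).
    by [].
  apply: (@le_trans _ _ (@leb R Z)).
    rewrite leb_rearrangement_level ?divr_ge0 ?(ltW lam0)// /distribution_fun.
    apply: le_measure; rewrite ?inE//; first exact: (measurable_level_set mI mEpsi).
    move=> t [It] /= ut; split => //=.
    by rewrite lte_fin ger0_norm ?psi_ge0// ltr_pdivrMr// mulrC.
  apply: leb_le_ae => //; apply: leb_aeS psi_rearr => t tw [It] /=.
  by rewrite tw// lte_fin ltr_pdivrMr// mulrC.
Qed.

Let h t : \bar R := rearrangement (@leb R) (itv0 a) (EFin \o phi) t / (w t)%:E.
Let g t : \bar R := (phi t / psi t)%:E.

Let hE t : itv0 a t -> h t = (phistar t / w t)%:E.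
(* Positivity of [w] turns the extended-real quotient into a real one. *)
Proof. by move=> It; rewrite /h -phistarE// inver gt_eqF ?w_gt0. Qed.

Let dh := distribution_fun (weighted_measure w) (itv0 a) h.
Let dg := distribution_fun (weighted_measure psi) (itv0 a) g.

Let dhE : dh = distribution_fun (weighted_measure w) (itv0 a)
  (fun t => (phistar t / w t)%:E).
Proof.
apply/funext => s; congr weighted_measure.
by apply/seteqP; split=> t [It] /= st; split => //; move: st; rewrite /= hE.
Qed.

Lemma fstar_over_weight_measurable : lebesgue_fun (itv0 a) h.
Proof.
have mq := quotient_lebesgue_measurable mphistar weight_lebesgue_measurable.
rewrite /lebesgue_fun; apply: eq_measurable_fun mq => t.
by rewrite inE => It; rewrite hE.
Qed.

Lemma distribution_fstar_over_weight_rcd : right_continuous_decreasing dh.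
Proof.
apply: distribution_weighted_rcd => //.
- exact: weight_lebesgue_measurable.
- by move=> t /w_gt0/ltW.
- exact: fstar_over_weight_measurable.
Qed.

Lemma distribution_quotient_rcd : right_continuous_decreasing dg.
Proof. by apply: distribution_weighted_rcd => //; exact: quotient_lebesgue_measurable. Qed.

(** The tail formula for the pairs (phistar, w) and (phi, psi) reduces this to integrating the
    comparison of levels over [u]. *)
Lemma integral_tail_le lam : (0 <= lam)%R ->
  \int[@leb R]_(s in `]lam, +oo[%classic) dh s <=
  \int[@leb R]_(s in `]lam, +oo[%classic) dg s.
Proof.
move=> lam0; rewrite dhE.
have [-> mh] := @integral_tail_distribution R I phistar w lam mI mphistar
  weight_lebesgue_measurable (fun t _ => phistar_ge0 t) (fun t It => ltW (w_gt0 It))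
  (fun t It wt => False_ind _ (elimF eqP (gt_eqF (w_gt0 It)) wt)) lam0.
have [-> mg] := integral_tail_distribution mI mphi mpsi phi_ge0 psi_ge0 psi_phi lam0.
by apply: ge0_le_integral => // u _; exact: leb_levels_le.
Qed.

Lemma integral_rearrangement_le (x : R) : (0 <= x)%R ->
  \int[@leb R]_(t in itv0 x%:E)
    rearrangement (weighted_measure w) (itv0 a) h t <=
  \int[@leb R]_(t in itv0 x%:E)
    rearrangement (weighted_measure psi) (itv0 a) g t.
Proof.
move=> x0; apply: (integral_generalized_inverse_le
  distribution_fstar_over_weight_rcd distribution_quotient_rcd).
- by move=> s; apply: distribution_weighted_ge0 => t /w_gt0/ltW.
- by move=> s; exact: distribution_weighted_ge0.
- exact: x0.
- exact: integral_tail_le.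
Qed.

End submajorization.

(** * Finiteness of rearrangements and of their integrals *)

Section norm_inequality.
Context {R : realType}.

Lemma leb_ae_forall (P : R -> Prop) : (forall t, P t) -> {ae @leb R, forall t, P t}.
Proof.
by move=> allP; exists set0; split; [exact: measurable0|exact: measure0|move=> t /(_ (allP t))].
Qed.

Lemma eq_rearrangement (mu : set R -> \bar R) (D : set R) (F G : R -> \bar R) :
  (forall t, D t -> F t = G t) -> rearrangement mu D F = rearrangement mu D G.
Proof.
move=> FG; rewrite !rearrangementE; congr generalized_inverse; apply/funext => s.
by congr mu; apply/seteqP; split=> t [Dt] /= h; split => //; move: h; rewrite /= FG.
Qed.

Lemma ae_eq_rearrangement (D : set R) (F G : R -> \bar R) :
  measurable (D : set (lebR R)) -> lebesgue_fun D F -> lebesgue_fun D G ->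
  {ae @leb R, forall t, D t -> `|F t| = `|G t|} ->
  rearrangement (@leb R) D F = rearrangement (@leb R) D G.
Proof.
move=> mD mF mG FG; rewrite !rearrangementE; congr generalized_inverse.
apply/funext => s; apply/eqP; rewrite eq_le; apply/andP; split; apply: leb_le_ae;
  try (exact: measurable_level_set); apply: leb_aeS FG => t FG [Dt] /= h; split => //.
  by rewrite -FG.
by rewrite /= FG.
Qed.

(** Chebyshev's inequality for the integrable part: off a set of measure at most [t] it stays below
    a constant, and the other part is essentially bounded. *)
Lemma rearrangement_L1_plus_Loo_fin_num (D : set R) (f : R -> R) (t : R) :
  measurable (D : set (lebR R)) -> L1_plus_Loo D f -> (0 < t)%R ->
  rearrangement (@leb R) D (EFin \o f) t \is a fin_num.
Proof.
move=> mD [mf [g [h [gL hL fgh]]]] t0.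
(* The norm with exponent +oo unfolds to an essential supremum once the whole space has positive
   measure. *)
have leb_gt0 : 0 < @leb R setT.
  apply: (@lt_le_trans _ _ (@leb R (itv0 1%:E))); first by rewrite leb_itv0 ?lte_fin ?lee_fin.
  by apply: le_measure; rewrite ?inE//; exact: measurable_itv0.
have [M hM] : exists M, {ae @leb R, forall t, (`|h t| <= M)%R}.
  move: hL; rewrite inE => /andP[_]; rewrite inE/= /finite_norm unlock /Lnorm leb_gt0.
  have -> : abse \o (EFin \o h) = EFin \o (fun t => `|h t|%R) by [].
  by move=> /ess_supr_bounded.
have /integrableP[mg ig] := (Lfun1_integrable (@leb R) g).1 gL.
set J := (X in X < +oo) in ig.
have J0 : 0 <= J by exact: integral_ge0.
(* Chosen so that K t = J + t >= J, with the summand 1 keeping [K] positive even if J = 0. *)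
pose K := (fine J / t + 1)%R.
have K0 : (0 < K)%R by rewrite ltr_wpDl// divr_ge0 ?fine_ge0// ltW.
have mgK : measurable [set t : lebR R | K%:E <= `|(EFin \o g) t|].
  have := measurable_lee measurableT (measurable_cst K%:E)
    (measurableT_comp (@abse_measurable R setT) mg).
  by rewrite setTI.
have gK : @leb R [set t | K%:E <= `|(EFin \o g) t|] <= t%:E.
  have := le_integral_comp_abse (@leb R) measurableT (f := id) (@measurable_id _ _ setT)
    (fun _ => id) (fun _ _ _ _ => id) mg K0.
  rewrite setTI => gKJ; rewrite -(@lee_pmul2l _ K%:E)//.
  apply: le_trans gKJ _; rewrite -/J -(@fineK _ J) ?ge0_fin_numE// -EFinM lee_fin.
  by rewrite /K mulrDl divfK ?gt_eqF// mul1r lerDl ltW.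
have dK : distribution_fun (@leb R) D (EFin \o f) (`|M| + K)%R <= t%:E.
  apply: le_trans gK; apply: leb_le_ae => //.
    by apply: measurable_level_set => //; exact/measurable_EFinP.
  apply: leb_aeS (leb_aeI hM fgh) => r [hr fr] [Dr] /=; rewrite lte_fin lee_fin fr//.
  move=> MK; have := lt_le_trans MK (ler_normD (g r) (h r)).
  have := le_trans hr (ler_norm M); lra.
rewrite ge0_fin_numE ?generalized_inverse_ge0//.
apply: (@le_lt_trans _ _ (`|M| + K)%:E); last by rewrite ltry.
apply: ge_ereal_inf; exists (`|M| + K)%:E => //; exists (`|M| + K)%R => //.
by split => //; rewrite ltr_wpDl.
Qed.

(** A decreasing function that is infinite at [t] is infinite on all of (0, t), which is not a null
    set. *)
Lemma generalized_inverse_ae_fin_num (d : R -> \bar R) (b : \bar R) :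
  {ae @leb R, forall t, itv0 b t -> generalized_inverse d t \is a fin_num} ->
  forall t, itv0 b t -> generalized_inverse d t \is a fin_num.
Proof.
move=> fin t [t0 tb]; rewrite ge0_fin_numE ?generalized_inverse_ge0// ltey.
apply/eqP => ty.
have : @leb R (itv0 t%:E) <= @leb R set0.
  apply: leb_le_ae; [exact: measurable_itv0|exact: measurable0|].
  apply: leb_aeS fin => s fins [s0 st].
  have /fins : itv0 b s by split => //; exact: lt_trans st tb.
  rewrite fin_numE => /andP[_ /eqP]; apply; apply/eqP; rewrite -leye_eq -ty.
  by apply: generalized_inverse_decr; exact: ltW.
by rewrite leb_itv0 ?measure0 ?lee_fin ?(ltW t0)// leNgt t0.
Qed.

Lemma rearrangement_fine_generalized_inverse (d : R -> \bar R) (b : \bar R) t :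
  right_continuous_decreasing d -> (forall s, 0 <= d s) ->
  (forall t, itv0 b t -> generalized_inverse d t \is a fin_num) -> itv0 b t ->
  rearrangement (@leb R) (itv0 b) (EFin \o (fine \o generalized_inverse d)) t =
  generalized_inverse d t.
Proof.
move=> rd d0 fin bt; rewrite -[RHS](rearrangement_generalized_inverse rd d0 bt).
by congr (_ t); apply: eq_rearrangement => s bs /=; rewrite fineK ?fin.
Qed.

(* Otherwise every measurable function is submajorized by g := fine \o d*, and
   so are its multiples: it has norm zero. *)
Lemma fully_symmetric_integral_lty (b : \bar R) (E : set (R -> R))
    (N : (R -> R) -> R) (d : R -> \bar R) (x : R) :
  fully_symmetric_space b E N -> right_continuous_decreasing d ->
  (forall s, 0 <= d s) ->
  (forall t, itv0 b t -> generalized_inverse d t \is a fin_num) ->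
  E (fine \o generalized_inverse d) -> itv0 b x ->
  \int[@leb R]_(t in itv0 x%:E) generalized_inverse d t < +oo.
Proof.
move=> [[bfs _] fs] rd d0 fin Ed bx; rewrite ltey; apply/eqP => intx.
have x0 : (0 < x)%R by case: bx.
(* The divergence sits at 0: on [y, x) the inverse is bounded by its finite value at [y], so
   removing this piece leaves an infinite integral. *)
have inty y : itv0 b y -> \int[@leb R]_(t in itv0 y%:E) generalized_inverse d t = +oo.
  move=> [y0 yb]; have [xy|yx] := leP x y.
    apply/eqP; rewrite -leye_eq -intx; apply: ge0_subset_integral.
    - exact: measurable_itv0.
    - exact: measurable_itv0.
    - exact: generalized_inverse_measurable.
    - by move=> t _; exact: generalized_inverse_ge0.
    - by move=> t [t0 tx]; split => //; apply: lt_le_trans tx _; rewrite lee_fin.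
  have xE : itv0 x%:E = itv0 y%:E `|` `[y, x[%classic.
    rewrite !itv0_fin; apply/seteqP; split=> t /=; rewrite !in_itv/=.
      by move=> /andP[t0 ->]; rewrite t0/= andbT; case: ltP; [left|right].
    case=> /andP[]; first by move=> -> /lt_trans ->.
    by move=> /(lt_le_trans y0) -> ->.
  move: intx; rewrite xE ge0_integral_setU; first last.
  - apply/disj_set2P/seteqP; split=> t //=; rewrite itv0_fin/= !in_itv/=.
    by move=> [/andP[_ ty] /andP[]]; rewrite leNgt ty.
  - by move=> t _; exact: generalized_inverse_ge0.
  - by rewrite -xE; exact: generalized_inverse_measurable.
  - exact: measurable_leb_itv.
  - exact: measurable_itv0.
  set I1 := (X in X + _); set I2 := (X in _ + X) => I12.
  have I2y : I2 < +oo.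
    apply: (@le_lt_trans _ _ (\int[@leb R]_(t in `[y, x[%classic) cst (generalized_inverse d y) t)).
      apply: ge0_le_leb_integral.
      + exact: interval_is_interval.
      + apply: nonincreasing_lebesgue_measurable; first exact: interval_is_interval.
        by move=> s t _ _; exact: generalized_inverse_decr.
      + exact: measurable_cst.
      + by move=> t _; exact: generalized_inverse_ge0.
      + by move=> t /=; rewrite in_itv/= => /andP[yt _]; exact: generalized_inverse_decr.
    rewrite integral_cst; last exact: measurable_leb_itv.
    have lebyx : @leb R `[y, x[%classic = (x - y)%:E by rewrite leb_itv/= lte_fin yx.
    rewrite [X in _ * X](_ : _ = (x - y)%:E); last exact: lebyx.
    by rewrite -(fineK (fin _ (conj y0 yb))) -EFinM ltry.
  apply/eqP; rewrite -leye_eq leNgt; apply/negP => I1y.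
  by have := lte_add_pinfty I1y I2y; rewrite I12 ltxx.
have all_sub (F : R -> R) : lebesgue_fun (itv0 b) F ->
    (N F <= N (fine \o generalized_inverse d))%R.
  move=> mF; apply: (fs _ _ mF Ed _).2 => y by_.
  rewrite [leRHS](_ : _ = +oo) ?leey// -(inty _ by_); apply: eq_integral => t.
  rewrite inE => -[t0 ty]; apply: rearrangement_fine_generalized_inverse => //.
  by split => //; apply: lt_trans ty _; case: by_.
have b0 : 0 < @leb R (itv0 b).
  rewrite leb_itv0; first by apply: lt_trans bx.2; rewrite lte_fin.
  by apply: le_trans (ltW bx.2); rewrite lee_fin ltW.
(* Full support provides an element [F] of [E] that is not a.e. zero. If N F were positive, the
   multiple of [F] of norm n + 1 would violate the bound [n]. *)
have [F EF nF] := bfs_full_support bfs (measurable_itv0 b) (fun _ => id) b0.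
apply/nF/(bfs_norm_eq0 bfs EF)/eqP; rewrite eq_le (bfs_norm_ge0 bfs EF) andbT leNgt.
apply/negP => NF; set n := N (fine \o generalized_inverse d) in all_sub.
have n0 : (0 <= n)%R by exact: bfs_norm_ge0 bfs _ Ed.
have := all_sub _ (bfs_measurable bfs (bfs_Z bfs ((n + 1) / N F)%R EF)).
rewrite (bfs_normZ bfs)// ger0_norm ?divr_ge0 ?addr_ge0 ?(ltW NF)//.
by rewrite divfK ?gt_eqF// leNgt ltrDl ltr01.
Qed.

End norm_inequality.

(** * Invariance under a.e. changes, and assembly of the submajorization and the norm inequality *)

Lemma ae_eq_weighted_measure {R : realType} (A B : set (lebR R)) (v psi : R -> R) :
  measurable A -> measurable B ->
  measurable_fun A (v : lebR R -> R) -> measurable_fun B (psi : lebR R -> R) ->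
  {ae @leb R, forall t, (A t <-> B t) /\ (A t -> v t = psi t)} ->
  weighted_measure v A = weighted_measure psi B.
Proof.
move=> mA mB /measurable_EFinP mv /measurable_EFinP mpsi AB.
rewrite /weighted_measure integral_mkcond [RHS]integral_mkcond.
apply: ae_eq_integral; first exact: measurableT.
- by apply: (measurable_restrictT (T1 := lebR R) _ mA).1.
- by apply: (measurable_restrictT (T1 := lebR R) _ mB).1.
apply: leb_aeS AB => t [AB vpsi] _; rewrite !patchE.
case: ifPn => [|/negP]; rewrite inE => At.
  by rewrite mem_set ?vpsi//; exact/AB.
by rewrite memNset// => /AB.
Qed.

(* [f / v] uses real division, for which [x / 0 = 0]: it vanishes wherever
   [f] does. *)
Theorem theorem3p1 (R : realType) (a b : \bar R) (w : R -> R)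
    (E : set (R -> R)) (N : (R -> R) -> R) (v f : R -> R)
    (a_gt0 : 0 < a)
    (w_gt0 : forall t, itv0 a t -> (0 < w t)%R)
    (w_decr : forall s t, itv0 a s -> itv0 a t -> (s <= t)%R -> (w t <= w s)%R)
    (bE : b = \int[@leb R]_(t in itv0 a) (w t)%:E)
    (E_fsym : fully_symmetric_space b E N)
    (E_supp : has_support (itv0 b) E)
    (v_meas : lebesgue_fun (itv0 a) v)
    (v_ge0 : {ae @leb R, forall t, itv0 a t -> (0 <= v t)%R})
    (v_rearr : {ae @leb R, forall t, itv0 a t ->
       rearrangement (@leb R) (itv0 a) (EFin \o v) t = (w t)%:E})
    (f_L1oo : L1_plus_Loo (itv0 a) f)
    (f_supp : {ae @leb R, forall t, itv0 a t -> f t <> 0%R -> v t <> 0%R}) :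
  let fstar_w := fun t =>
    rearrangement (@leb R) (itv0 a) (EFin \o f) t / (w t)%:E in
  let f_v := fun t => (f t / v t)%:E in
  submajorized b
    (rearrangement (weighted_measure w) (itv0 a) fstar_w)
    (rearrangement (weighted_measure v) (itv0 a) f_v) /\
  (weighted_space a b E v f_v ->
     weighted_space a b E w fstar_w /\
     (weighted_norm a N w fstar_w <= weighted_norm a N v f_v)%R).
Proof.
move=> fstar_w f_v.
(* Replacements for v and |f|: they are nonnegative, and [phi] vanishes wherever [psi] does, at
   every point; the sign of v and the support condition make them agree a.e. with the originals. *)
pose psi t : R := Num.max (v t) 0%R.
pose phi t : R := (`|f t / psi t| * psi t)%R.
have mI := measurable_itv0 a.
have a0 : 0 <= a by exact: ltW.
have mf : lebesgue_fun (itv0 a) f := f_L1oo.1.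
have mpsi : lebesgue_fun (itv0 a) psi.
  exact: measurable_maxr v_meas (measurable_cst (0%R : R)).
have mphi : lebesgue_fun (itv0 a) phi.
  have mq : measurable_fun (itv0 a : set (lebR R)) (fun t : lebR R => (f t / psi t)%R).
    exact/measurable_EFinP/quotient_lebesgue_measurable.
  exact: measurable_funM (measurableT_comp (@normr_measurable R setT) mq) mpsi.
have psi_ge0 t : (0 <= psi t)%R by rewrite /psi le_max lexx orbT.
have phi_ge0 t : (0 <= phi t)%R by rewrite mulr_ge0.
have psi_phi t : psi t = 0%R -> phi t = 0%R by move=> psi0; rewrite /phi psi0 mulr0.
have ae_v : {ae @leb R, forall t, itv0 a t -> psi t = v t /\ phi t = `|f t|%R}.
  apply: leb_aeS (leb_aeI v_ge0 f_supp) => t [v0 fv] It.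
  have psiv : psi t = v t by apply/max_idPl; exact: v0.
  split => //; rewrite /phi psiv.
  have [ft0|/eqP ft0] := eqVneq (f t) 0%R; first by rewrite ft0 mul0r normr0 mul0r.
  have vt0 : v t != 0%R by apply/eqP; exact: fv.
  by rewrite normrM normfV [X in (_ / X)%R]ger0_norm ?v0// divfK.
have phi_rearr : rearrangement (@leb R) (itv0 a) (EFin \o f) =
    rearrangement (@leb R) (itv0 a) (EFin \o phi).
  apply: ae_eq_rearrangement => //; [exact/measurable_EFinP|exact/measurable_EFinP|].
  by apply: leb_aeS ae_v => t h /h[_ ph] /=; rewrite ph normr_id.
have v_psi_rearr : rearrangement (@leb R) (itv0 a) (EFin \o v) =
    rearrangement (@leb R) (itv0 a) (EFin \o psi).
  apply: ae_eq_rearrangement => //; [exact/measurable_EFinP|exact/measurable_EFinP|].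
  by apply: leb_aeS ae_v => t h /h[pv _] /=; rewrite pv.
rewrite v_psi_rearr in v_rearr.
have phi_fin t : itv0 a t ->
    rearrangement (@leb R) (itv0 a) (EFin \o phi) t \is a fin_num.
  by move=> [t0 _]; rewrite -phi_rearr; exact: rearrangement_L1_plus_Loo_fin_num.
have fstar_wE : fstar_w =
    fun t => rearrangement (@leb R) (itv0 a) (EFin \o phi) t / (w t)%:E.
  by rewrite /fstar_w phi_rearr.
(* Off a null set the weights agree and so do the absolute values of the quotients, hence the
   distribution functions coincide. *)
have f_vE : rearrangement (weighted_measure v) (itv0 a) f_v =
    rearrangement (weighted_measure psi) (itv0 a) (fun t => (phi t / psi t)%:E).
  rewrite !rearrangementE; congr generalized_inverse; apply/funext => s.
  have mf_v := quotient_lebesgue_measurable mf v_meas.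
  have mphi_psi := quotient_lebesgue_measurable mphi mpsi.
  have mA := measurable_level_set mI mf_v s.
  have mB := measurable_level_set mI mphi_psi s.
  apply: ae_eq_weighted_measure => //.
  - by apply: measurable_funS mI _ v_meas => t [].
  - by apply: measurable_funS mI _ mpsi => t [].
  apply: leb_aeS (leb_aeI v_ge0 ae_v) => t [v0 h]; split; last first.
    by move=> [/h[->]].
  have e : itv0 a t -> `|(phi t / psi t)%:E| = `|f_v t|.
    move=> It; have [-> ->] := h It; rewrite /f_v /=; congr EFin.
    by rewrite !normrM normr_id.
  split=> -[It st]; (split; first exact: It); rewrite /mkset;
    [rewrite (e It)|rewrite -(e It)]; exact: st.
set dh := distribution_fun (weighted_measure w) (itv0 a) fstar_w.
set dg := distribution_fun (weighted_measure psi) (itv0 a) (fun t => (phi t / psi t)%:E).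
have dh_rcd : right_continuous_decreasing dh.
  rewrite /dh fstar_wE; exact: distribution_fstar_over_weight_rcd.
have dg_rcd : right_continuous_decreasing dg by exact: distribution_quotient_rcd.
have dh0 s : 0 <= dh s by apply: distribution_weighted_ge0 => t /w_gt0/ltW.
have dg0 s : 0 <= dg s by exact: distribution_weighted_ge0.
have int_le x : itv0 b x -> \int[@leb R]_(t in itv0 x%:E) generalized_inverse dh t <=
    \int[@leb R]_(t in itv0 x%:E) generalized_inverse dg t.
  move=> [x0 _]; rewrite /dh fstar_wE.
  exact: (integral_rearrangement_le a0 w_gt0 w_decr mphi mpsi (fun t _ => phi_ge0 t)
    (fun t _ => psi_ge0 t) (fun t _ => @psi_phi t) v_rearr phi_fin (ltW x0)).
have itv0_sub x : itv0 b x -> itv0 x%:E `<=` itv0 b.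
  by move=> [_ xb] t [t0 tx]; split => //; exact: lt_trans tx xb.
rewrite /weighted_space /weighted_norm f_vE -/dg.
rewrite (rearrangementE (weighted_measure w)) (rearrangementE (weighted_measure psi)) -/dh -/dg.
split.
  (* Submajorization rearranges both sides once more on J, which leaves generalized inverses
     unchanged there. *)
  move=> x bx; have := int_le _ bx; congr (_ <= _); apply: eq_integral => t;
    by rewrite inE => /(itv0_sub _ bx) bt; rewrite rearrangement_generalized_inverse.
move=> [_ _ /generalized_inverse_ae_fin_num dg_fin Eg].
(* An infinite value at [t] would, by monotonicity, give an infinite integral over (0, t), hence
   also for the inverse of [dg], whose membership in [E] excludes this. *)
have dh_fin t : itv0 b t -> generalized_inverse dh t \is a fin_num.
  move=> bt; have t0 : (0 < t)%R by case: bt.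
  rewrite ge0_fin_numE ?generalized_inverse_ge0// ltey; apply/eqP => ty.
  have := fully_symmetric_integral_lty E_fsym dg_rcd dg0 dg_fin Eg bt.
  apply/negP; rewrite -leNgt; apply: le_trans (int_le _ bt).
  apply: (@le_trans _ _ (\int[@leb R]_(s in itv0 t%:E) cst (generalized_inverse dh t) s)).
    rewrite integral_cst; last exact: measurable_itv0.
    rewrite [X in _ * X](_ : _ = t%:E); last by apply: leb_itv0; rewrite lee_fin ltW.
    by rewrite ty gt0_mulye.
  apply: ge0_le_leb_integral.
  - exact: is_interval_itv0.
  - exact: measurable_cst.
  - exact: generalized_inverse_measurable.
  - by move=> s _; exact: generalized_inverse_ge0.
  - by move=> s [_ st]; apply: generalized_inverse_decr; rewrite -lee_fin ltW.
(* Both inverses being finite on J, [fine] loses nothing there and full symmetry applies to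
   [int_le]. *)
have [Eh Nh] : E (fine \o generalized_inverse dh) /\
    (N (fine \o generalized_inverse dh) <= N (fine \o generalized_inverse dg))%R.
  apply: (E_fsym.2 _ _ _ Eg).
    exact: measurableT_comp (@fine_measurable R setT measurableT)
      (@generalized_inverse_measurable R dh b).
  move=> x bx; have := int_le _ bx; congr (_ <= _); apply: eq_integral => t;
    by rewrite inE => /(itv0_sub _ bx) bt; rewrite rearrangement_fine_generalized_inverse.
split; [split|exact: Nh].
- by rewrite fstar_wE; exact: fstar_over_weight_measurable.
- apply: leb_ae_forall => t It; rewrite fstar_wE fin_numM ?phi_fin//.
  by rewrite inver gt_eqF ?w_gt0.
- by apply: leb_ae_forall => t; exact: dh_fin.
- exact: Eh.
Qed.
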